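(* Let $P\subseteq S_n$ be a permutation array with Hamming distance $d$, and let $Q\subseteq S_{n-2}$ be the array obtained from $P$ by applying the contraction operation two times, i.e. $Q=\{(\sigma^{CT})^{CT}\mid \sigma\in P\}$. Then: (a) the Hamming distance of $Q$ is at least $d-6$; (b) if, for any distinct $\sigma,\tau\in P$, the cycle decomposition of $\sigma^{-1}\tau$ contains no 3-cycle and no 5-cycle, then the Hamming distance of $Q$ is at least $d-4$.
   Context: $S_m$ is the symmetric group on $Z_m=\{0,\dots,m-1\}$, with composition $(\pi\sigma)(i)=\sigma(\pi(i))$. For $\sigma\in S_m$, its contraction $\sigma^{CT}\in S_{m-1}$ is defined for $0\le x\le m-2$ by $\sigma^{CT}(x)=\sigma(x)$ if $\sigma(x)\ne m-1$, and $\sigma^{CT}(x)=\sigma(m-1)$ if $\sigma(x)=m-1$. $hd(\pi,\sigma)$ is the number of points where $\pi,\sigma$ differ; the Hamming distance of an array is the minimum of $hd$ over pairs of distinct elements. *)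

(* Defs.v *)
From mathcomp Require Import all_boot all_fingroup.
Set Implicit Arguments.
Unset Strict Implicit.
Unset Printing Implicit Defensive.

(* MathComp composes permutations from left to right, (s * t) i = t (s i)
   (permM), which is the convention (pi sigma)(i) = sigma (pi i). *)

Section Contraction.

Variables (m : nat) (s : 'S_m.+1).

Local Notation emb := (@lift m.+1 ord_max).

(* [emb x] is x itself, seen in Z_{m+1}; ord_max is the letter m. *)
Definition contraction_val (x : 'I_m) : 'I_m.+1 :=
  if s (emb x) == ord_max then s ord_max else s (emb x).

Lemma contraction_val_neq x : ord_max != contraction_val x.
Proof.
rewrite /contraction_val; case: (eqVneq (s (emb x)) ord_max) => [sx|].
  apply/negP=> /eqP sm; have /perm_inj/eqP : s (emb x) = s ord_max.
    by rewrite sx.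
  by rewrite eq_sym (negPf (neq_lift _ _)).
by rewrite eq_sym.
Qed.

(* The default value x is never used, by contraction_val_neq. *)
Definition contraction_fun (x : 'I_m) : 'I_m :=
  odflt x (unlift ord_max (contraction_val x)).

Lemma lift_contraction_fun x :
  emb (contraction_fun x) = contraction_val x.
Proof.
by rewrite /contraction_fun; have [j ej ->] := unlift_some (contraction_val_neq x).
Qed.

Lemma contraction_fun_inj : injective contraction_fun.
Proof.
move=> x y /(congr1 emb); rewrite !lift_contraction_fun.
have sm_neq z : s ord_max <> s (emb z).
  by move=> /perm_inj/eqP; rewrite (negPf (neq_lift _ _)).
rewrite /contraction_val.
case: (eqVneq (s (emb x)) ord_max) => [sx|_];
  case: (eqVneq (s (emb y)) ord_max) => [sy|_].
- by move=> _; apply/(@lift_inj m.+1 ord_max)/(@perm_inj _ s); rewrite sx sy.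
- by move/sm_neq.
- by move/esym/sm_neq.
- by move/perm_inj/lift_inj.
Qed.

Definition contraction : 'S_m := perm contraction_fun_inj.

Lemma contractionE x :
  contraction x =
    (if s (widen_ord (leqnSn m) x) == ord_max then s ord_max
     else s (widen_ord (leqnSn m) x)) :> nat.
Proof.
have -> : widen_ord (leqnSn m) x = emb x.
  by apply/val_inj; rewrite /= /bump leqNgt ltn_ord.
rewrite permE -[RHS](congr1 val (lift_contraction_fun x)) /=.
by rewrite /bump leqNgt ltn_ord.
Qed.

End Contraction.

Section HammingDistance.

Variable m : nat.

Definition hd (s t : 'S_m) : nat := #|[set i | s i != t i]|.

Definition distinct_pairs (A : {set 'S_m}) : {set 'S_m * 'S_m} :=
  [set st in setX A A | st.1 != st.2].

(* The minimum is over an empty set when A has at most one element; the value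
   is then 0 by convention.  In particular a positive lower bound on
   [hamming_distance A] entails that A has at least two elements. *)
Definition hamming_distance (A : {set 'S_m}) : nat :=
  if [pick st in distinct_pairs A] is Some st0 then
    let st := [arg min_(st < st0 in distinct_pairs A) hd st.1 st.2] in
    hd st.1 st.2
  else 0.

Lemma hamming_distanceP (A : {set 'S_m}) : 1 < #|A| ->
  (exists s t, [/\ s \in A, t \in A, s != t & hd s t = hamming_distance A]) /\
  (forall s t, s \in A -> t \in A -> s != t -> hamming_distance A <= hd s t).
Proof.
case/card_gt1P=> a [b [Aa Ab neq_ab]]; rewrite /hamming_distance.
case: pickP => [st0 st0P|/(_ (a, b))]; last by rewrite !inE /= Aa Ab neq_ab.
case: arg_minnP => //= -[s t]; rewrite !inE /= => /andP[/andP[As At] neq_st] le.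
split=> [|s' t' As' At' neq_st']; first by exists s, t.
by apply: (le (s', t')); rewrite !inE /= As' At'.
Qed.

End HammingDistance.

Definition has_cycle_of_length m (k : nat) (s : 'S_m) : bool :=
  [exists C in porbits s, #|C| == k].

(* Main.v *)
Require Import Defs.
From mathcomp Require Import all_boot all_fingroup.

(** Write M for the largest letter, a = s M, b = t M and g = s^-1 t, so that
    g a = b.  Contracting s and t can only destroy a difference at M, at
    s^-1 M (when g M = a) and at t^-1 M (when g b = M).  All three are lost only
    if (M a b) is a 3-cycle of g.  If exactly two are lost, then, up to exchanging
    s and t, g maps M to a and a to b, and contraction replaces
    p -> M -> a -> b by p -> b; hence a 3-cycle of the contracted quotient comes
    from a 3-cycle or a 5-cycle of g. *)

Set Implicit Arguments.
Unset Strict Implicit.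
Unset Printing Implicit Defensive.

(** An explicit list lets short cycles be written letter by letter. The successor [k.+1] excludes
    the empty list, which is vacuously a cycle but lists no orbit. *)
Lemma has_cycle_of_lengthP m k (g : 'S_m) :
  reflect (exists c, [/\ fcycle g c, uniq c & size c = k.+1])
          (has_cycle_of_length k.+1 g).
Proof.
have card_porbit x : #|porbit g x| = fingraph.order g x.
  apply: eq_card => y; apply/porbitP/idP => [[i ->]|gxy].
    by rewrite permX; apply: fconnect_iter.
  by exists (findex g x y); rewrite permX iter_findex.
apply: (iffP existsP) => [[_ /andP[/imsetP[x _ ->] /eqP cx]]|].
  exists (fingraph.orbit g x); rewrite orbit_uniq size_orbit -card_porbit.
  by split=> //; apply/cycle_orbit/perm_inj.
case=> -[|x c] [gc uc sc] //; exists (porbit g x).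
by rewrite imset_f // card_porbit (order_cycle gc uc (mem_head x c)) sc eqxx.
Qed.

Lemma has_cycle_of_lengthV m k (g : 'S_m) :
  has_cycle_of_length k g^-1 = has_cycle_of_length k g.
Proof. by rewrite /has_cycle_of_length porbitsV. Qed.

Lemma hdC m (s t : 'S_m) : hd s t = hd t s.
Proof. by apply: eq_card => i; rewrite !inE eq_sym. Qed.

Lemma lift_contraction m (s : 'S_m.+1) x :
  lift ord_max (contraction s x) =
    if s (lift ord_max x) == ord_max then s ord_max else s (lift ord_max x).
Proof. by rewrite permE lift_contraction_fun. Qed.

Section Contraction.

Variables (m : nat) (s t : 'S_m.+1).

Local Notation M := (@ord_max m).
Local Notation emb := (lift M).
Local Notation g := (s^-1 * t)%g.
Local Notation g' := ((contraction s)^-1 * contraction t)%g.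

Lemma hd_contraction :
  hd s t <= hd (contraction s) (contraction t) + (s M != t M)
    + ((g M == s M) && (s M != M)) + ((g (t M) == M) && (t M != M)).
Proof.
(* The cardinal of [opt b x] is [b], so the union bound below yields the three Booleans. *)
pose opt (b : bool) x : {set 'I_m.+1} := if b then [set x] else set0.
have card_opt b x : #|opt b x| = b by case: b; rewrite /= ?cards1 ?cards0.
pose D' := [set i | contraction s i != contraction t i].
set b1 := s M != t M; set b2 := _ && _; set b3 := _ && _.
have sub : [set i | s i != t i] \subset
    emb @: D' :|: opt b1 M :|: opt b2 (s^-1 M)%g :|: opt b3 (t^-1 M)%g.
  apply/subsetP=> i; rewrite !inE => nst.
  case: (unliftP M i) nst => [j ->|->] nst; last first.
    by rewrite /b1 nst /= set11 !orbT.
  have [dj|/negP] := boolP (contraction s j != contraction t j).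
    by rewrite (mem_imset _ _ (@lift_inj _ _)) inE dj.
  move/negP; rewrite negbK => /eqP/(congr1 emb).
  rewrite !lift_contraction.
  (* A difference is lost only if exactly one of [s], [t] sends the letter to [M]: for [s] this
     forces [g M = s M], for [t] it forces [g (t M) = M]. *)
  case: eqP => [sj|/eqP sj]; case: eqP => [tj|/eqP tj].
  - by rewrite sj tj eqxx in nst.
  - move=> e; have ej : emb j = (s^-1 M)%g by apply: (canRL (permK s)).
    by rewrite /b2 permM -ej e eqxx tj /= set11 !orbT.
  - move=> e; have ej : emb j = (t^-1 M)%g by apply: (canRL (permK t)).
    have -> : b3 by rewrite /b3 permM -e permK tj eqxx sj.
    by rewrite ej /= set11 !orbT.
  - by move=> e; rewrite e eqxx in nst.
apply: leq_trans (subset_leq_card sub) _.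
do 3![apply: leq_trans (leq_card_setU _ _) _; rewrite card_opt leq_add2r].
by rewrite (card_imset _ (@lift_inj _ _)).
Qed.

Lemma quotient_max : g (s M) = t M.
Proof. by rewrite permM permK. Qed.

Lemma hd_contraction3 : hd s t <= hd (contraction s) (contraction t) + 3.
Proof.
apply: leq_trans hd_contraction _; rewrite -!addnA leq_add2l.
by case: (_ != _); case: (_ && _); case: (_ && _).
Qed.

Lemma hd_contraction2 : ~~ has_cycle_of_length 3 g ->
  hd s t <= hd (contraction s) (contraction t) + 2.
Proof.
move=> no3; apply: leq_trans hd_contraction _; rewrite -!addnA leq_add2l.
have [st|//] := boolP (s M != t M); last by case: (_ && _); case: (_ && _).
case: andP => [[gM sM]|_]; last by case: (_ && _).
case: andP => [[gt tM]|//].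
case/has_cycle_of_lengthP: no3; exists [:: M; s M; t M].
by rewrite /= quotient_max gM gt eqxx !inE st negb_or ![M == _]eq_sym sM tM.
Qed.

(** Away from [s M], a letter has the same preimage under [s] and [contraction s]. An arrow of [g]
    into [M] is redirected to [t M = g (s M)] rather than to [g M], so [g'] need not be the
    contraction of [g]. *)
Lemma lift_contraction_quotient x : emb x != s M ->
  emb (g' x) = if g (emb x) == M then t M else g (emb x).
Proof.
rewrite -[x](permKV (contraction s)); move: ((contraction s)^-1 x)%g => w.
rewrite permM permK !lift_contraction permM.
by case: (s (emb w) =P M) => [_|_ _]; rewrite ?eqxx // permK.
Qed.

(** The preimage of [s M] under [contraction s] is [s^-1 M], which [t] sends to [g M = s M]; so both
    contractions agree there. *)
Lemma contraction_quotient_fix x : g M = s M -> s M != M ->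
  emb x = s M -> g' x = x.
Proof.
move=> gM sM; rewrite -[x](permKV (contraction s)).
move: ((contraction s)^-1 x)%g => w; rewrite permM permK lift_contraction => ew.
apply: (@lift_inj _ M); rewrite !lift_contraction ew.
case: eqP ew => [sw _|_ /perm_inj/eqP]; last by rewrite eq_sym (negPf (neq_lift _ _)).
have -> : t (emb w) = s M by rewrite -gM permM -(canRL (permK s) sw).
by rewrite (negPf sM).
Qed.

Lemma contraction_quotient_3cycle : g M = s M -> s M != M ->
  ~~ has_cycle_of_length 3 g -> ~~ has_cycle_of_length 5 g ->
  ~~ has_cycle_of_length 3 g'.
Proof.
move=> gM sM no3 no5; apply/has_cycle_of_lengthP => -[c [gc uc sc]].
case: c sc gc uc => [|x [|y [|z [|? ?]]]] //= _ /and4P[/eqP gx /eqP gy /eqP gz _].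
rewrite !inE negb_or andbT => /andP[/andP[xy xz] yz].
(* Since [g'] fixes [s M], the letters of the 3-cycle avoid it and [lift_contraction_quotient]
   applies to each of them. *)
have emb_neq u v : g' u = v -> u != v -> emb u != s M.
  by move=> guv; apply: contraNneq => /(contraction_quotient_fix gM sM) <-; rewrite guv.
have xa := emb_neq _ _ gx xy.
have ya := emb_neq _ _ gy yz.
have za : emb z != s M by apply: emb_neq gz _; rewrite eq_sym.
(* A 3-cycle of g' through p and b, with g p = M, comes from a 5-cycle. *)
have via_max p q r : p != q -> p != r -> q != r ->
    emb p != s M -> emb q != s M -> emb r != s M ->
    g' p = q -> g' q = r -> g' r = p -> g (emb p) != M.
  move=> pq pr qr pa qa ra gp gq gr; apply/negP=> /eqP gpM.
  (* By injectivity only [p] is sent to [M], so the arrows from [q] and [r] are already arrows of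
     [g]. *)
  have gN u : u != p -> (g (emb u) == M) = false.
    by move=> up; rewrite -[X in _ == X]gpM (inj_eq perm_inj) (inj_eq lift_inj) (negPf up).
  have := lift_contraction_quotient pa; rewrite gp gpM eqxx => eq_b.
  have := lift_contraction_quotient qa; rewrite gq gN 1?eq_sym // => eq_r.
  have := lift_contraction_quotient ra; rewrite gr gN 1?eq_sym // => eq_p.
  (* Here [emb q] is [t M], the image of [s M] under [g]. *)
  case/has_cycle_of_lengthP: no5; exists [:: M; s M; emb q; emb r; emb p].
  rewrite /= gM quotient_max -eq_b -eq_r -eq_p gpM !eqxx !inE !negb_or.
  rewrite !(inj_eq lift_inj) !neq_lift [M == _]eq_sym sM ![s M == _]eq_sym pa qa ra.
  by rewrite qr ![_ == p]eq_sym pq pr.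
have gxM := via_max x y z xy xz yz xa ya za gx gy gz.
have gyM : g (emb y) != M by apply: (via_max y z x) => //; rewrite eq_sym.
have gzM : g (emb z) != M by apply: (via_max z x y) => //; rewrite eq_sym.
case/has_cycle_of_lengthP: no3; exists [:: emb x; emb y; emb z].
have step u : emb u != s M -> g (emb u) != M -> g (emb u) = emb (g' u).
  by move=> ua uM; rewrite lift_contraction_quotient // (negPf uM).
rewrite /= (step x) // (step y) // (step z) // gx gy gz !eqxx !inE !(inj_eq lift_inj) negb_or.
by rewrite xy xz yz.
Qed.

End Contraction.

Lemma hd_contraction1 m (s t : 'S_m.+1) :
  ~~ has_cycle_of_length 3 (s^-1 * t)%g -> ~~ has_cycle_of_length 5 (s^-1 * t)%g ->
  has_cycle_of_length 3 ((contraction s)^-1 * contraction t)%g ->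
  hd s t <= hd (contraction s) (contraction t) + 1.
Proof.
move=> no3 no5 cyc; apply: leq_trans (hd_contraction s t) _.
case: andP => [[/eqP gM sM]|_].
  by rewrite (negPf (contraction_quotient_3cycle gM sM no3 no5)) in cyc.
(* The condition [g (t M) = M] says that [g^-1 M = t M]: it is the previous case with [s] and [t]
   exchanged, and inversion preserves cycle lengths. *)
case: andP => [[/eqP gt tM]|_]; last first.
  by rewrite !addn0 leq_add2l leq_b1.
have invE k (u v : 'S_k) : (v^-1 * u)%g = (u^-1 * v)^-1%g by rewrite invMg invgK.
have gM : (t^-1 * s)%g ord_max = t ord_max by rewrite invE -[in LHS]gt permK.
have := contraction_quotient_3cycle gM tM.
by rewrite !(invE _ s t) (invE _ (contraction s)) !has_cycle_of_lengthV no3 no5 cyc => /(_ isT isT).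
Qed.

Lemma hd_contraction_twice6 n (s t : 'S_n.+2) :
  hd s t <= hd (contraction (contraction s)) (contraction (contraction t)) + 6.
Proof.
apply: leq_trans (hd_contraction3 s t) _.
by rewrite (addnA _ 3 3) leq_add2r hd_contraction3.
Qed.

(** If the first contraction creates a 3-cycle in the quotient, the two losses are at most 1 and 3;
    otherwise each is at most 2. *)
Lemma hd_contraction_twice4 n (s t : 'S_n.+2) :
  ~~ has_cycle_of_length 3 (s^-1 * t)%g -> ~~ has_cycle_of_length 5 (s^-1 * t)%g ->
  hd s t <= hd (contraction (contraction s)) (contraction (contraction t)) + 4.
Proof.
move=> no3 no5.
have [cyc|no3'] := boolP (has_cycle_of_length 3 ((contraction s)^-1 * contraction t)%g).
  apply: leq_trans (hd_contraction1 no3 no5 cyc) _.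
  by rewrite (addnA _ 3 1) leq_add2r hd_contraction3.
apply: leq_trans (hd_contraction2 no3) _.
by rewrite (addnA _ 2 2) leq_add2r hd_contraction2.
Qed.

Lemma hamming_distance_le1 m (A : {set 'S_m}) : #|A| <= 1 -> hamming_distance A = 0.
Proof.
move=> /card_le1_eqP A1; rewrite /hamming_distance.
case: pickP => // -[s t]; rewrite !inE /= => /andP[/andP[As At]].
by rewrite (A1 _ _ As At) eqxx.
Qed.

Lemma hamming_distance_imset m k e (f : 'S_m -> 'S_k) (A : {set 'S_m}) :
  (forall s t, s \in A -> t \in A -> s != t -> hd s t <= hd (f s) (f t) + e) ->
  hamming_distance A - e <= hamming_distance (f @: A).
Proof.
move=> le_hd; rewrite leq_subLR addnC.
have [A1|A2] := leqP #|A| 1; first by rewrite hamming_distance_le1.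
have [_ minA] := hamming_distanceP A2.
have leA s t : s \in A -> t \in A -> s != t -> hamming_distance A <= hd (f s) (f t) + e.
  by move=> As At st; apply: leq_trans (minA _ _ As At st) (le_hd _ _ As At st).
(* If the image has a single element, its distance is 0 by convention; two distinct elements of [A]
   then have equal images, so the distance of [A] is at most [e]. *)
have [B1|B2] := leqP #|f @: A| 1.
  have [s [t [As At st]]] := card_gt1P A2.
  apply: leq_trans (leA s t As At st) _; rewrite leq_add2r.
  move/card_le1_eqP: B1 => /(_ (f s) (f t)) -> //; rewrite ?imset_f //.
  by rewrite [hd _ _]eq_card0 // => i; rewrite !inE eqxx.
have [[_ [_ [/imsetP[s As ->] /imsetP[t At ->] fst <-]]] _] := hamming_distanceP B2.
by apply: leA => //; apply: contraNneq fst => ->.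
Qed.

Theorem theorem3 (n d : nat) (P : {set 'S_n.+2}) (Q : {set 'S_n})
    (distP : hamming_distance P = d)
    (defQ : Q = [set contraction (contraction s) | s in P]) :
  (d - 6 <= hamming_distance Q) /\
  ((forall s t : 'S_n.+2, s \in P -> t \in P -> s != t ->
      ~~ has_cycle_of_length 3 (s^-1 * t)%g /\
      ~~ has_cycle_of_length 5 (s^-1 * t)%g) ->
   d - 4 <= hamming_distance Q).
Proof.
rewrite -distP defQ; split=> [|no35]; apply: hamming_distance_imset => s t Ps Pt st.
  exact: hd_contraction_twice6.
by have [no3 no5] := no35 s t Ps Pt st; apply: hd_contraction_twice4.
Qed.
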